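(* Let $m,n$ be positive integers, let $p,q\in\{1,2,\infty\}$, and let $A\in L(\mathbb{R}^n;\mathbb{R}^m)$ be a real $m\times n$ matrix with entries $A_{aj}$, $a\in\{1,\dots,m\}$, $j\in\{1,\dots,n\}$. The induced norm $\|\cdot\|_{p,q}$ satisfies the following formulae: (i) $\|A\|_{1,1}=\max\{\|c(A,j)\|_1 \mid j\in\{1,\dots,n\}\}$; (ii) $\|A\|_{1,2}=\max\{\|c(A,j)\|_2 \mid j\in\{1,\dots,n\}\}$; (iii) $\|A\|_{1,\infty}=\max\{|A_{aj}| \mid a\in\{1,\dots,m\},\ j\in\{1,\dots,n\}\}=\max\{\|c(A,j)\|_\infty \mid j\in\{1,\dots,n\}\}=\max\{\|r(A,a)\|_\infty \mid a\in\{1,\dots,m\}\}$; (iv) $\|A\|_{2,1}=\max\{\|A^T u\|_2 \mid u\in\{-1,1\}^m\}$; (v) $\|A\|_{2,2}=\max\{\sqrt{\lambda} \mid \lambda \text{ is an eigenvalue of } A^TA\}$; (vi) $\|A\|_{2,\infty}=\max\{\|r(A,a)\|_2 \mid a\in\{1,\dots,m\}\}$; (vii) $\|A\|_{\infty,1}=\max\{\|A u\|_1 \mid u\in\{-1,1\}^n\}$; (viii) $\|A\|_{\infty,2}=\max\{\|A u\|_2 \mid u\in\{-1,1\}^n\}$; (ix) $\|A\|_{\infty,\infty}=\max\{\|r(A,a)\|_1 \mid a\in\{1,\dots,m\}\}$.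
   Context: For $x=(x_1,\dots,x_n)\in\mathbb{R}^n$, $\|x\|_1=\sum_{j=1}^n|x_j|$, $\|x\|_2=\left(\sum_{j=1}^n|x_j|^2\right)^{1/2}$, $\|x\|_\infty=\max\{|x_1|,\dots,|x_n|\}$, and similarly on $\mathbb{R}^m$. $L(\mathbb{R}^n;\mathbb{R}^m)$ is the set of linear maps from $\mathbb{R}^n$ to $\mathbb{R}^m$, identified with the set of real $m\times n$ matrices in the usual way. For $p,q\in\{1,2,\infty\}$, the norm of $A\in L(\mathbb{R}^n;\mathbb{R}^m)$ induced by the $p$-norm on $\mathbb{R}^n$ and the $q$-norm on $\mathbb{R}^m$ is $\|A\|_{p,q}=\sup\{\|Ax\|_q \mid x\in\mathbb{R}^n,\ \|x\|_p=1\}$. The vector $r(A,a)\in\mathbb{R}^n$ denotes the $a$th row of $A$, the vector $c(A,j)\in\mathbb{R}^m$ denotes the $j$th column of $A$, and $A^T$ denotes the transpose of $A$. *)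

(* Defs.v *)
From HB Require Import structures.
From mathcomp Require Import all_boot all_order all_algebra.
From mathcomp Require Import boolp classical_sets reals.

Set Implicit Arguments.
Unset Strict Implicit.
Unset Printing Implicit Defensive.

Import Order.TTheory GRing.Theory Num.Theory.

Local Open Scope classical_set_scope.
Local Open Scope ring_scope.

Inductive norm_exponent : Type := one_norm | two_norm | max_norm.

(* The base value 0 of the iterated maximum is harmless for n > 0, since the
   terms are nonnegative. *)
Definition vnorm (R : realType) (p : norm_exponent) (n : nat) (x : 'cV[R]_n)
  : R :=
  match p with
  | one_norm => \sum_(j < n) `|x j 0|
  | two_norm => Num.sqrt (\sum_(j < n) `|x j 0| ^+ 2)
  | max_norm => \big[Num.max/0]_(j < n) `|x j 0|
  end.

Definition induced_norm (R : realType) (p q : norm_exponent) (m n : nat)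
    (A : 'M[R]_(m, n)) : R :=
  sup [set vnorm q (A *m x) | x in [set x : 'cV[R]_n | vnorm p x = 1]].

(* row a A is a 1 x n matrix; vectors are columns here. *)
Definition row_vec (R : realType) (m n : nat) (A : 'M[R]_(m, n)) (a : 'I_m)
  : 'cV[R]_n := (row a A)^T.

Definition sign_vectors (R : realType) (k : nat) : set 'cV[R]_k :=
  [set u | forall i, u i 0 = -1 \/ u i 0 = 1].
Arguments sign_vectors : clear implicits.

(* "v = max S": the maximum exists (it is attained) and equals v. *)
Definition is_max (R : realType) (S : set R) (v : R) : Prop :=
  S v /\ ubound S v.

(* Main.v *)
Require Import Defs.
From HB Require Import structures.
From mathcomp Require Import all_boot all_order all_algebra.
From mathcomp Require Import boolp classical_sets reals.
From mathcomp Require Import ring lra.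

(** The whole argument rests on the duality between the 1-norm and the
    max-norm, and of the 2-norm with itself.  Writing p* for the exponent dual
    to p, the inequality |<u, x>| <= ||u||_{p*} ||x||_p ([holder]) is attained
    for every u by some unit x ([norming_vector]), and when p is the max-norm
    this x can be taken among the sign vectors.  Every norm ||Ax||_q is thus a
    value <y, Ax> = <A^T y, x> with ||y||_{q*} = 1.

    Two sets of reals with the same downward closure have the same supremum
    ([sup_cofinal]).  An induced norm is therefore the maximum of any nonempty
    finite set S of reals such that each norm ||Ax||_q, with ||x||_p = 1, is below an
    element of S and vice versa.  This comparison is made directly when q is
    the max-norm (S consists of the dual norms of the rows) and when p is the
    max-norm (S is given by the sign vectors).  The identity
    ||A||_{p,q} = ||A^T||_{q*,p*} ([induced_norm_trmx]) transports these two
    formulae to p = 1 (columns) and q = 1 (sign vectors, through A^T).  All the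
    formulae but the one for the spectral norm are instances of these four,
    the largest entry being the largest max-norm of a column.

    For the spectral norm s = ||A||_{2,2}, every eigenvalue l of A^T A with
    eigenvector x satisfies l <x, x> = <Ax, Ax> <= s^2 <x, x>, so it remains to
    see that s^2 is an eigenvalue.  The matrix Q = s^2 I - A^T A is symmetric
    and positive semidefinite.  Were it invertible, the Cauchy-Schwarz
    inequality for its own quadratic form would bound <x, Qx> below by a
    positive multiple of <x, x> ([psd_unitmx_coercive]), hence ||Ax||^2 on the
    unit sphere by a constant less than s^2, against the definition of s. *)

Set Implicit Arguments.
Unset Strict Implicit.
Unset Printing Implicit Defensive.

Import Order.TTheory GRing.Theory Num.Theory.

Local Open Scope classical_set_scope.
Local Open Scope ring_scope.

(* Simplification should evaluate dual exponents without unfolding the norms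
   that they index. *)
#[local] Arguments vnorm : simpl never.

(** * Suprema and maxima *)

(** A supremum only depends on the downward closure of its set, and the two
    hypotheses say that these closures coincide. *)
Lemma sup_cofinal (R : realType) (S T : set R) :
  S `<=` down T -> T `<=` down S -> sup S = sup T.
Proof.
move=> ST TS; rewrite -(sup_down S) -(sup_down T); congr sup.
rewrite eqEsubset; split=> x [y [+ xy]].
  by move=> /ST[z [Tz yz]]; exists z; split=> //; exact: le_trans xy yz.
by move=> /TS[z [Sz yz]]; exists z; split=> //; exact: le_trans xy yz.
Qed.

Lemma is_max_sup (R : realType) (S : set R) (v : R) :
  is_max S v -> is_max S (sup S).
Proof.
move=> [Sv ubv]; suff -> : sup S = v by [].
apply/eqP; rewrite eq_le ge_sup ?ub_le_sup //; by exists v.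
Qed.

Lemma is_max_sup_image (R : realType) (I : finType) (i0 : I) (F : I -> R) :
  is_max (range F) (sup (range F)).
Proof.
have [i _ imax] := @arg_maxP _ R I i0 xpredT F isT.
apply: (@is_max_sup _ _ (F i)); split; first by exists i.
by move=> _ [j _ <-]; exact: imax.
Qed.

(** There are only finitely many sign vectors, even though they are given as a
    set of vectors over [R]: they are the images of the boolean functions. *)
Lemma is_max_sup_sign_vectors (R : realType) (k : nat) (F : 'cV[R]_k -> R) :
  is_max (F @` sign_vectors R k) (sup (F @` sign_vectors R k)).
Proof.
pose sgn (f : {ffun 'I_k -> bool}) : 'cV[R]_k := \col_i (-1) ^+ f i.
suff -> : F @` sign_vectors R k = range (F \o sgn).
  exact: (is_max_sup_image [ffun=> false]).
rewrite eqEsubset; split=> _ [u uP <-].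
  exists [ffun i => u i 0 == -1] => //=; congr F.
  apply/colP => i; rewrite !mxE ffunE.
  (* -1 and 1 must be distinct for the test u i = -1 to recover u. *)
  have neq : (1 == -1 :> R) = false by rewrite eq_sym eqNr oner_eq0.
  by case: (uP i) => ->; rewrite ?eqxx ?neq ?expr1 ?expr0.
exists (sgn u) => // i; rewrite mxE; case: (u i); [left|right].
  by rewrite expr1.
by rewrite expr0.
Qed.

(** * Dual norms *)

Definition dot (R : realType) (n : nat) (u v : 'cV[R]_n) : R :=
  (u^T *m v) 0 0.

Definition dual_exponent (p : norm_exponent) : norm_exponent :=
  match p with
  | one_norm => max_norm
  | two_norm => two_norm
  | max_norm => one_norm
  end.

Lemma dual_exponentK : involutive dual_exponent.
Proof. by case. Qed.

Section Dot.
Context (R : realType).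
Implicit Types m n : nat.

Lemma dotE n (u v : 'cV[R]_n) : dot u v = \sum_j u j 0 * v j 0.
Proof. by rewrite /dot mxE; apply: eq_bigr => j _; rewrite mxE. Qed.

Lemma dotC n (u v : 'cV[R]_n) : dot u v = dot v u.
Proof. by rewrite !dotE; apply: eq_bigr => j _; rewrite mulrC. Qed.

Lemma dot_mulmx m n (A : 'M[R]_(m, n)) (u : 'cV[R]_m) (v : 'cV[R]_n) :
  dot u (A *m v) = dot (A^T *m u) v.
Proof. by rewrite /dot trmx_mul trmxK mulmxA. Qed.

Lemma dotDr n (u v w : 'cV[R]_n) : dot u (v + w) = dot u v + dot u w.
Proof. by rewrite /dot mulmxDr mxE. Qed.

Lemma dotBr n (u v w : 'cV[R]_n) : dot u (v - w) = dot u v - dot u w.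
Proof. by rewrite /dot mulmxBr !mxE. Qed.

Lemma dotZr n c (u v : 'cV[R]_n) : dot u (c *: v) = c * dot u v.
Proof. by rewrite /dot -scalemxAr mxE. Qed.

Lemma dotDl n (u v w : 'cV[R]_n) : dot (v + w) u = dot v u + dot w u.
Proof. by rewrite dotC dotDr !(dotC u). Qed.

Lemma dotZl n c (u v : 'cV[R]_n) : dot (c *: u) v = c * dot u v.
Proof. by rewrite dotC dotZr dotC. Qed.

Lemma dot_ge0 n (u : 'cV[R]_n) : 0 <= dot u u.
Proof. by rewrite dotE sumr_ge0 // => j _; rewrite -expr2 sqr_ge0. Qed.

Lemma dot_eq0 n (u : 'cV[R]_n) : (dot u u == 0) = (u == 0).
Proof.
apply/idP/eqP => [|->]; last by rewrite -(scale0r 0) dotZl mul0r.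
rewrite dotE psumr_eq0 => [/allP u0|j _]; last by rewrite -expr2 sqr_ge0.
apply/colP => j; rewrite mxE; apply/eqP.
by have := u0 j (mem_index_enum _); rewrite -expr2 sqrf_eq0.
Qed.

Lemma dot_gt0 n (u : 'cV[R]_n) : (0 < dot u u) = (u != 0).
Proof. by rewrite lt_def dot_ge0 andbT dot_eq0. Qed.

Lemma dot_row_vec m n (A : 'M[R]_(m, n)) (a : 'I_m) (x : 'cV[R]_n) :
  dot (row_vec A a) x = (A *m x) a 0.
Proof. by rewrite /dot trmxK -row_mul mxE. Qed.

(** The form <z, Qz> is nonnegative at every s x + t y, so its discriminant as
    a quadratic form in (s, t) is nonpositive.  Taking Q = 1 gives the usual
    inequality, and
    [psd_unitmx_coercive] applies the general one. *)
Lemma psd_cauchy_schwarz n (Q : 'M[R]_n) (x y : 'cV[R]_n) :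
  Q^T = Q -> (forall z, 0 <= dot z (Q *m z)) ->
  dot x (Q *m y) ^+ 2 <= dot x (Q *m x) * dot y (Q *m y).
Proof.
move=> symQ psdQ.
set d := dot x (Q *m y); set a := dot x _; set c := dot y _.
have yx : dot y (Q *m x) = d by rewrite dot_mulmx symQ dotC.
have quad s t : 0 <= s ^+ 2 * a + 2 * s * t * d + t ^+ 2 * c.
  have := psdQ (s *: x + t *: y).
  rewrite mulmxDr -!scalemxAr !(dotDr, dotDl, dotZr, dotZl) yx -/a -/c -/d.
  by congr (0 <= _); ring.
have c_ge0 : 0 <= c := psdQ y.
have a_ge0 : 0 <= a := psdQ x.
(* s = c, t = -d yields 0 <= c (a c - d^2), which is enough unless c = 0. *)
have [c0|c_gt0] := leP c 0; last first.
  by rewrite -(ler_pM2l c_gt0); have := quad c (- d); lra.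
(* If c = 0, the form is s (s a + 2 t d), and d = 0 follows. *)
have {}c0 : c = 0 by lra.
rewrite c0 mulr0.
have [a0|a_gt0] := leP a 0; first by have := quad 1 (- d); rewrite c0; lra.
by rewrite -(ler_pM2l a_gt0); have := quad d (- a); rewrite c0; lra.
Qed.

Lemma cauchy_schwarz n (x y : 'cV[R]_n) :
  dot x y ^+ 2 <= dot x x * dot y y.
Proof.
have := @psd_cauchy_schwarz n 1%:M x y (trmx1 _ _).
by rewrite !mul1mx; apply=> z; rewrite mul1mx dot_ge0.
Qed.

End Dot.

Section Vnorm.
Context (R : realType).
Implicit Types (m n : nat) (p q : norm_exponent).

Lemma vnorm_twoE n (x : 'cV[R]_n) : vnorm two_norm x = Num.sqrt (dot x x).
Proof.
rewrite /vnorm dotE; congr Num.sqrt; apply: eq_bigr => j _.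
by rewrite real_normK ?num_real.
Qed.

Lemma vnorm_two_eq1 n (x : 'cV[R]_n) :
  vnorm two_norm x = 1 <-> dot x x = 1.
Proof.
rewrite vnorm_twoE; split=> [x1|->]; last exact: sqrtr1.
by rewrite -[LHS]sqr_sqrtr ?dot_ge0 // x1 expr1n.
Qed.

Lemma vnorm_ge0 p n (x : 'cV[R]_n) : 0 <= vnorm p x.
Proof.
rewrite /vnorm; case: p; [exact: sumr_ge0|exact: sqrtr_ge0|exact: bigmax_ge_id].
Qed.

Lemma ler_vnorm_max n (x : 'cV[R]_n) j : `|x j 0| <= vnorm max_norm x.
Proof. exact: (le_bigmax 0 (fun j => `|x j 0|)). Qed.

Lemma vnorm_max_attained n (x : 'cV[R]_n) :
  (0 < n)%N -> exists j, vnorm max_norm x = `|x j 0|.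
Proof.
move=> n_gt0.
have [//|j _ xj] := @eq_bigmax _ R _ 0 (Ordinal n_gt0) xpredT
  (fun j => `|x j 0|) isT.
by exists j.
Qed.

Lemma vnorm_sign_vector n (u : 'cV[R]_n) :
  (0 < n)%N -> sign_vectors R n u -> vnorm max_norm u = 1.
Proof.
move=> /(vnorm_max_attained u)[j ->] /(_ j)[] ->; by rewrite ?normrN normr1.
Qed.

Lemma holder_one_max n (u x : 'cV[R]_n) :
  `|dot u x| <= vnorm max_norm u * vnorm one_norm x.
Proof.
rewrite dotE (le_trans (ler_norm_sum _ _ _)) // /vnorm mulr_sumr.
by apply: ler_sum => j _; rewrite normrM ler_wpM2r // ler_vnorm_max.
Qed.

Lemma holder p n (u x : 'cV[R]_n) :
  `|dot u x| <= vnorm (dual_exponent p) u * vnorm p x.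
Proof.
case: p; first exact: holder_one_max.
- rewrite !vnorm_twoE.
  rewrite -sqrtrM ?dot_ge0 // -sqrtr_sqr ler_wsqrtr //.
  exact: cauchy_schwarz.
- by rewrite dotC mulrC; exact: holder_one_max.
Qed.

Lemma sign_vector_norming n (x : 'cV[R]_n) :
  exists2 u, sign_vectors R n u & dot u x = vnorm one_norm x.
Proof.
exists (\col_j (if x j 0 < 0 then -1 else 1)) => [j|].
  by rewrite mxE; case: ifP; [left|right].
rewrite dotE; apply: eq_bigr => j _; rewrite mxE.
by case: ltP => [/ltr0_norm|/ger0_norm] ->; rewrite ?mulN1r ?mul1r.
Qed.

Lemma dot_deltal n j (x : 'cV[R]_n) : dot (delta_mx j 0) x = x j 0.
Proof. by rewrite /dot trmx_delta -rowE mxE. Qed.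

Lemma vnorm_one_delta n (j : 'I_n) c :
  vnorm one_norm (c *: delta_mx j 0 : 'cV[R]_n) = `|c|.
Proof.
rewrite /vnorm (bigD1 j) //= big1 ?addr0 => [|i ij].
  by rewrite !mxE !eqxx mulr1.
by rewrite !mxE (negbTE ij) mulr0 normr0.
Qed.

Lemma dot_delta n (j : 'I_n) : dot (delta_mx j 0) (delta_mx j 0 : 'cV[R]_n) = 1.
Proof. by rewrite dot_deltal mxE !eqxx. Qed.

Lemma dot_normalize n (x : 'cV[R]_n) : x != 0 ->
  let y := (vnorm two_norm x)^-1 *: x in
  dot y y = 1 /\ dot y x = vnorm two_norm x.
Proof.
rewrite vnorm_twoE -dot_gt0 => x_gt0 /=; set s := Num.sqrt _.
have s0 : s != 0 by rewrite gt_eqF // sqrtr_gt0.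
have -> : dot (s^-1 *: x) x = s.
  by rewrite dotZl -(sqr_sqrtr (ltW x_gt0)) expr2 mulrA mulVf // mul1r.
have xx : dot x x = s * s by rewrite -expr2 sqr_sqrtr // ltW.
by rewrite dotZl dotZr xx; split=> //; field.
Qed.

(** The supporting functionals of the three unit balls: a signed basis vector
    at a largest coordinate for the 1-norm, the normalized vector itself for the
    2-norm, the vector of signs for the max-norm. *)
Lemma norming_vector p n (x : 'cV[R]_n) : (0 < n)%N ->
  exists2 y, vnorm p y = 1 & dot y x = vnorm (dual_exponent p) x.
Proof.
move=> n_gt0; case: p.
- have [j xj] := vnorm_max_attained x n_gt0.
  exists ((if x j 0 < 0 then -1 else 1) *: delta_mx j 0).
    by rewrite vnorm_one_delta; case: ifP; rewrite ?normrN normr1.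
  rewrite dotZl dot_deltal xj.
  by case: ltP => [/ltr0_norm|/ger0_norm] ->; rewrite ?mulN1r ?mul1r.
(* The zero vector cannot be normalized, but any unit vector norms it. *)
- have [->|x0] := eqVneq x 0.
    exists (delta_mx (Ordinal n_gt0) 0).
      by apply/vnorm_two_eq1; rewrite dot_delta.
    by rewrite dot_deltal mxE vnorm_twoE /dot mulmx0 mxE sqrtr0.
  have [y1 yx] := dot_normalize x0; exists ((vnorm two_norm x)^-1 *: x) => //.
  exact/vnorm_two_eq1.
- have [u su ux] := sign_vector_norming x.
  by exists u => //; exact: vnorm_sign_vector.
Qed.

(** * Induced norms *)

(** If y norms Ax, then ||Ax||_q = <A^T y, x> is at most the dual norm of
    A^T y, since x is a unit vector. *)
Lemma induced_values_trmx p q m n (A : 'M[R]_(m, n)) : (0 < m)%N ->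
  [set vnorm q (A *m x) | x in [set x | vnorm p x = 1]] `<=`
  down [set vnorm (dual_exponent p) (A^T *m y) |
        y in [set y | vnorm (dual_exponent q) y = 1]].
Proof.
move=> m_gt0 _ [x /= x1 <-].
have [y y1 yAx] := norming_vector (dual_exponent q) (A *m x) m_gt0.
exists (vnorm (dual_exponent p) (A^T *m y)); split; first by exists y.
rewrite dual_exponentK in yAx; rewrite -yAx dot_mulmx.
by rewrite (le_trans (ler_norm _)) // (le_trans (holder p _ _)) // x1 mulr1.
Qed.

(** A matrix and its transpose have the same norm for dual exponents: the
    preceding comparison, applied to A and then to A^T, makes the two sets of
    values cofinal. *)
Lemma induced_norm_trmx p q m n (A : 'M[R]_(m, n)) :
  (0 < m)%N -> (0 < n)%N ->
  induced_norm p q A = induced_norm (dual_exponent q) (dual_exponent p) A^T.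
Proof.
move=> m_gt0 n_gt0; apply: sup_cofinal; first exact: induced_values_trmx.
by rewrite -{2}[p]dual_exponentK -{2}[q]dual_exponentK -{2}[A]trmxK;
  exact: induced_values_trmx.
Qed.

(** The coordinates of Ax are the numbers <r(A,a), x>, whose largest value over
    the unit ball of the p-norm is the dual norm of r(A,a). *)
Lemma is_max_induced_norm_rows p m n (A : 'M[R]_(m, n)) :
  (0 < m)%N -> (0 < n)%N ->
  is_max [set vnorm (dual_exponent p) (row_vec A a) | a in [set: 'I_m]]
         (induced_norm p max_norm A).
Proof.
move=> m_gt0 n_gt0; set S := (X in is_max X _).
suff <- : sup S = induced_norm p max_norm A.
  exact: (is_max_sup_image (Ordinal m_gt0)).
apply: sup_cofinal.
  move=> _ [a _ <-].
  have [x x1 ax] := norming_vector p (row_vec A a) n_gt0.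
  exists (vnorm max_norm (A *m x)); split; first by exists x.
  by rewrite -ax dotC dot_row_vec (le_trans (ler_norm _)) ?ler_vnorm_max.
move=> _ [x /= x1 <-]; have [a ->] := vnorm_max_attained (A *m x) m_gt0.
exists (vnorm (dual_exponent p) (row_vec A a)); split; first by exists a.
by rewrite -dot_row_vec (le_trans (holder p _ _)) // x1 mulr1.
Qed.

(** A convex function on the cube is maximal at a vertex.  Duality gives
    the vertex: if y norms Ax and u is the vector of signs of A^T y,
    then ||Ax||_q = <A^T y, x> <= ||A^T y||_1 = <y, Au> <= ||Au||_q. *)
Lemma is_max_induced_norm_signs q m n (A : 'M[R]_(m, n)) :
  (0 < m)%N -> (0 < n)%N ->
  is_max [set vnorm q (A *m u) | u in sign_vectors R n]
         (induced_norm max_norm q A).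
Proof.
move=> m_gt0 n_gt0; set S := (X in is_max X _).
suff <- : sup S = induced_norm max_norm q A.
  exact: (is_max_sup_sign_vectors (fun u => vnorm q (A *m u))).
apply: sup_cofinal.
  move=> _ [u su <-]; exists (vnorm q (A *m u)); split=> //.
  by exists u => //; exact: vnorm_sign_vector.
move=> _ [x /= x1 <-].
have [y y1 yAx] := norming_vector (dual_exponent q) (A *m x) m_gt0.
rewrite dual_exponentK in yAx.
have [u su uAy] := sign_vector_norming (A^T *m y).
exists (vnorm q (A *m u)); split; first by exists u.
rewrite -yAx dot_mulmx (le_trans (ler_norm _)) //.
rewrite (le_trans (holder max_norm _ _)) // x1 mulr1 /=.
rewrite -uAy dot_mulmx trmxK (le_trans (ler_norm _)) //.
by rewrite (le_trans (holder (dual_exponent q) _ _)) // dual_exponentK y1 mulr1.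
Qed.

Lemma is_max_induced_norm_cols q m n (A : 'M[R]_(m, n)) :
  (0 < m)%N -> (0 < n)%N ->
  is_max [set vnorm q (col j A) | j in [set: 'I_n]]
         (induced_norm one_norm q A).
Proof.
move=> m_gt0 n_gt0; rewrite induced_norm_trmx //=.
have := is_max_induced_norm_rows (dual_exponent q) A^T n_gt0 m_gt0.
rewrite dual_exponentK; congr is_max; apply: eq_imagel => j _.
by rewrite /row_vec -tr_col trmxK.
Qed.

Lemma is_max_induced_norm_trmx_signs p m n (A : 'M[R]_(m, n)) :
  (0 < m)%N -> (0 < n)%N ->
  is_max [set vnorm (dual_exponent p) (A^T *m u) | u in sign_vectors R m]
         (induced_norm p one_norm A).
Proof.
move=> m_gt0 n_gt0; rewrite induced_norm_trmx //=.
exact: is_max_induced_norm_signs.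
Qed.

Lemma is_max_induced_norm_entries m n (A : 'M[R]_(m, n)) :
  (0 < m)%N -> (0 < n)%N ->
  is_max [set `|A a j| | a in [set: 'I_m] & j in [set: 'I_n]]
         (induced_norm one_norm max_norm A).
Proof.
move=> m_gt0 n_gt0.
have [[j _ <-] ubA] := is_max_induced_norm_cols max_norm A m_gt0 n_gt0.
split.
  have [a ->] := vnorm_max_attained (col j A) m_gt0.
  by exists a => //; exists j => //; rewrite mxE.
move=> _ [a _ [k _ <-]]; apply: (@le_trans _ _ (vnorm max_norm (col k A))).
  by have := ler_vnorm_max (col k A) a; rewrite mxE.
by apply: ubA; exists k.
Qed.

(** * The spectral norm *)

(** Cauchy-Schwarz on each row; C is the square of the Frobenius norm. *)
Lemma dot_mulmx_bounded m n (A : 'M[R]_(m, n)) :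
  exists2 C, 0 <= C & forall x, dot (A *m x) (A *m x) <= C * dot x x.
Proof.
exists (\sum_a dot (row_vec A a) (row_vec A a)).
  by apply: sumr_ge0 => a _; exact: dot_ge0.
move=> x; rewrite [leLHS]dotE mulr_suml; apply: ler_sum => a _.
by rewrite -expr2 -dot_row_vec cauchy_schwarz.
Qed.

Lemma has_ubound_induced_two m n (A : 'M[R]_(m, n)) :
  has_ubound [set vnorm two_norm (A *m x) | x in [set x | vnorm two_norm x = 1]].
Proof.
have [C _ AC] := dot_mulmx_bounded A; exists (Num.sqrt C).
move=> _ [x /vnorm_two_eq1 x1 <-].
by rewrite vnorm_twoE ler_wsqrtr // (le_trans (AC x)) // x1 mulr1.
Qed.

Lemma induced_norm_two_ge0 m n (A : 'M[R]_(m, n)) :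
  0 <= induced_norm two_norm two_norm A.
Proof.
rewrite /induced_norm; set S := (X in sup X).
have [[[y Sy] ubS]|/sup_out -> //] := pselect (has_sup S).
rewrite (le_trans _ (ub_le_sup ubS Sy)) //.
by case: Sy => x _ <-; exact: vnorm_ge0.
Qed.

(** The inequality ||Ax||_2 <= ||A||_{2,2} ||x||_2 for all x, squared so as to
    be expressed by the quadratic form of A^T A. *)
Lemma dot_mulmx_le_induced_norm m n (A : 'M[R]_(m, n)) x :
  dot (A *m x) (A *m x) <= induced_norm two_norm two_norm A ^+ 2 * dot x x.
Proof.
have [->|x0] := eqVneq x 0; first by rewrite /dot !mulmx0 mxE mulr0.
have [s [y [-> y1]]] : exists s y, x = s *: y /\ dot y y = 1.
  have [y1 _] := dot_normalize x0.
  exists (vnorm two_norm x), ((vnorm two_norm x)^-1 *: x); split=> //.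
  by rewrite scalerA mulfV ?scale1r // vnorm_twoE gt_eqF // sqrtr_gt0 dot_gt0.
rewrite -scalemxAr !(dotZl, dotZr) y1.
suff : dot (A *m y) (A *m y) <= induced_norm two_norm two_norm A ^+ 2.
  have := sqr_ge0 s; nra.
rewrite -[leLHS]sqr_sqrtr ?dot_ge0 // -vnorm_twoE.
rewrite ler_pXn2r ?nnegrE ?vnorm_ge0 ?induced_norm_two_ge0 //.
apply: (ub_le_sup (has_ubound_induced_two A)).
by exists y => //=; apply/vnorm_two_eq1.
Qed.

(** An invertible positive semidefinite form is definite, with a uniform
    constant.  Let N = <Qx, Qx> = <x, Q(Qx)>.  Cauchy-Schwarz for Q gives
    N^2 <= <x, Qx> <Qx, Q(Qx)> <= <x, Qx> c N, so N <= c <x, Qx>, and <x, x> is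
    bounded by a multiple of N because Q has an inverse. *)
Lemma psd_unitmx_coercive n (Q : 'M[R]_n) (c : R) :
  Q^T = Q -> (forall x, 0 <= dot x (Q *m x)) ->
  (forall x, dot x (Q *m x) <= c * dot x x) ->
  Q \in unitmx ->
  exists2 K, 0 <= K & forall x, dot x x <= K * dot x (Q *m x).
Proof.
move=> symQ psdQ Qc unitQ; have [D D_ge0 QD] := dot_mulmx_bounded (invmx Q).
exists (D * `|c|) => [|x]; first by rewrite mulr_ge0.
set N := dot (Q *m x) (Q *m x).
have xN : dot x x <= D * N by have := QD (Q *m x); rewrite mulKmx.
have N_ge0 : 0 <= N := dot_ge0 _.
have NE : N ^+ 2 <= dot x (Q *m x) * dot (Q *m x) (Q *m (Q *m x)).
  have := psd_cauchy_schwarz x (Q *m x) symQ psdQ.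
  by rewrite [dot x (Q *m (Q *m x))]dot_mulmx symQ.
rewrite (le_trans xN) // -mulrA ler_wpM2l //.
have [->|N0] := eqVneq N 0; first by rewrite mulr_ge0.
have N_gt0 : 0 < N by rewrite lt_def N0.
rewrite -(ler_pM2r N_gt0) -expr2 (le_trans NE) //.
rewrite mulrAC [leRHS]mulrC ler_wpM2l // (le_trans (Qc _)) //.
by rewrite ler_wpM2r // ler_norm.
Qed.

(** If s^2 is not an eigenvalue, then Q = s^2 I - A^T A is invertible, hence
    coercive, and ||Ax||^2 <= s^2 - 1/K for all unit x, contradicting the
    choice of s as the least upper bound of ||Ax||. *)
Lemma eigenvalue_induced_norm_two m n (A : 'M[R]_(m, n)) : (0 < n)%N ->
  eigenvalue (A^T *m A) (induced_norm two_norm two_norm A ^+ 2).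
Proof.
move=> n_gt0; set s := induced_norm _ _ A.
apply: contraT; rewrite negbK kermx_eq0 row_free_unit => unitM.
pose Q : 'M[R]_n := (s ^+ 2)%:M - A^T *m A.
have QE x : dot x (Q *m x) = s ^+ 2 * dot x x - dot (A *m x) (A *m x).
  rewrite /Q mulmxBl mul_scalar_mx dotBr dotZr -mulmxA dot_mulmx.
  by congr (_ - _); exact: dotC.
have symQ : Q^T = Q.
  by rewrite /Q linearB /= trmx_mul trmxK tr_scalar_mx.
have [x|x||K K_ge0 coerQ] := @psd_unitmx_coercive n Q (s ^+ 2) symQ.
- by rewrite QE subr_ge0 dot_mulmx_le_induced_norm.
- by rewrite QE gerBl dot_ge0.
- by rewrite /Q -opprB -scaleN1r unitmxZ ?unitrN1.
have gap x : dot x x = 1 -> 1 <= K * (s ^+ 2 - dot (A *m x) (A *m x)).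
  by move=> x1; have := coerQ x; rewrite QE x1 mulr1.
(* Evaluating the bounds at one unit vector shows that K is positive and
   s^2 - 1/K is nonnegative, so that its square root can be squared back. *)
pose e : 'cV[R]_n := delta_mx (Ordinal n_gt0) 0.
have K_gt0 : 0 < K.
  rewrite lt_def K_ge0 andbT; apply/eqP => K0.
  by have := gap e (dot_delta _); rewrite K0 mul0r ler10.
have As x : dot x x = 1 -> dot (A *m x) (A *m x) <= s ^+ 2 - K^-1.
  by move=> /gap; rewrite -ler_pdivrMl // mulr1; lra.
have s_ge0 : 0 <= s := induced_norm_two_ge0 A.
have d_ge0 : 0 <= s ^+ 2 - K^-1.
  by rewrite (le_trans (dot_ge0 _) (As e (dot_delta _))).
have : s <= Num.sqrt (s ^+ 2 - K^-1).
  apply: ge_sup.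
    by exists (vnorm two_norm (A *m e)), e => //; apply/vnorm_two_eq1/dot_delta.
  move=> _ [x /vnorm_two_eq1 x1 <-]; rewrite vnorm_twoE ler_wsqrtr //.
  exact: As.
rewrite -(@ler_pXn2r _ 2%N) ?nnegrE ?sqrtr_ge0 // sqr_sqrtr //.
by rewrite lerDl oppr_ge0 invr_le0 leNgt K_gt0.
Qed.

Lemma is_max_induced_norm_two m n (A : 'M[R]_(m, n)) : (0 < n)%N ->
  is_max [set Num.sqrt l | l in [set l : R | eigenvalue (A^T *m A) l]]
         (induced_norm two_norm two_norm A).
Proof.
move=> n_gt0; have s_ge0 := induced_norm_two_ge0 A.
split; first exists (induced_norm two_norm two_norm A ^+ 2).
- exact: eigenvalue_induced_norm_two.
- by rewrite sqrtr_sqr ger0_norm.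
(* Eigenvectors are rows here; A^T A being symmetric, v^T is a right
   eigenvector for the same eigenvalue. *)
move=> _ [l /eigenvalueP[v vl v0] <-].
rewrite -[leRHS]ger0_norm // -sqrtr_sqr ler_wsqrtr //.
have x_gt0 : 0 < dot v^T v^T by rewrite dot_gt0 trmx_eq0.
rewrite -(ler_pM2r x_gt0) (le_trans _ (dot_mulmx_le_induced_norm A v^T)) //.
rewrite dot_mulmx dotC mulmxA.
have -> : A^T *m A *m v^T = l *: v^T.
  by rewrite -linearZ -vl /= !trmx_mul trmxK.
by rewrite dotZr.
Qed.

End Vnorm.

Theorem theorem2p1 (R : realType) (m n : nat) (hm : (0 < m)%N) (hn : (0 < n)%N)
    (A : 'M[R]_(m, n)) :
  is_max [set vnorm one_norm (col j A) | j in [set: 'I_n]]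
         (induced_norm one_norm one_norm A)
  /\
  is_max [set vnorm two_norm (col j A) | j in [set: 'I_n]]
         (induced_norm one_norm two_norm A)
  /\
  (is_max [set `|A a j| | a in [set: 'I_m] & j in [set: 'I_n]]
          (induced_norm one_norm max_norm A)
   /\ is_max [set vnorm max_norm (col j A) | j in [set: 'I_n]]
             (induced_norm one_norm max_norm A)
   /\ is_max [set vnorm max_norm (row_vec A a) | a in [set: 'I_m]]
             (induced_norm one_norm max_norm A))
  /\
  is_max [set vnorm two_norm (A^T *m u) | u in sign_vectors R m]
         (induced_norm two_norm one_norm A)
  /\
  is_max [set Num.sqrt lambda | lambda in [set l : R | eigenvalue (A^T *m A) l]]
         (induced_norm two_norm two_norm A)
  /\
  is_max [set vnorm two_norm (row_vec A a) | a in [set: 'I_m]]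
         (induced_norm two_norm max_norm A)
  /\
  is_max [set vnorm one_norm (A *m u) | u in sign_vectors R n]
         (induced_norm max_norm one_norm A)
  /\
  is_max [set vnorm two_norm (A *m u) | u in sign_vectors R n]
         (induced_norm max_norm two_norm A)
  /\
  is_max [set vnorm one_norm (row_vec A a) | a in [set: 'I_m]]
         (induced_norm max_norm max_norm A).
Proof.
split; first exact: is_max_induced_norm_cols.
split; first exact: is_max_induced_norm_cols.
split.
  split; first exact: is_max_induced_norm_entries.
  split; first exact: is_max_induced_norm_cols.
  exact: (is_max_induced_norm_rows one_norm).
split; first exact: (is_max_induced_norm_trmx_signs two_norm).
split; first exact: is_max_induced_norm_two.
split; first exact: (is_max_induced_norm_rows two_norm).
split; first exact: is_max_induced_norm_signs.
split; first exact: is_max_induced_norm_signs.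
exact: (is_max_induced_norm_rows max_norm).
Qed.
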